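(* The marked-graph bracket polynomial $[G]\in\mathbb{Z}[A,B,d]$ of any marked graph $G$ can be calculated recursively using the following properties. That is, the bracket has properties (a)–(f), valid for all marked graphs $G$, and these properties suffice to determine $[G]$ for every marked graph $G$. (a) The empty graph (no vertices, no free loops) has $[\emptyset]=1$, and the one-vertex graphs without free loops have $$[(v)]=[(v,r,\ell)]=Ad+B=[(v,u)]=[(v,ur,\ell)],$$ $$[(v,\ell)]=[(v,r)]=A+Bd=[(v,u,\ell)]=[(v,ur)],$$ $$[(v,c)]=[(v,cr,\ell)]=A+B=[(v,c,\ell)]=[(v,cr)].$$ Here the symbol $\ell$ is present exactly when $v$ is looped, and the symbol among $r,c,cr,u,ur$, if present, is the mark of $v$ (if absent, $v$ is unmarked). (b) If $G'$ is obtained from $G$ by removing a free loop then $[G]=d\cdot[G']$. (c) If $G'$ is obtained from $G$ by removing an isolated vertex $v$ then $[G]=[\{v\}]\cdot[G']$, where $[\{v\}]$ is the bracket, given in (a), of the one-vertex graph in which $v$ has the same mark and loop status as in $G$. (d) If the vertex $v$ of $G$ is unlooped and marked $c$, or looped and marked $cr$, then $[G]=A[G-v]+B[G_{cru}^{v}-v]$. If $v$ is looped and marked $c$, or unlooped and marked $cr$, then $[G]=B[G-v]+A[G_{cru}^{v}-v]$. (e) If the vertex $v$ of $G$ has a neighbor marked $u$ or $ur$ then $[G]=[G_{cru}^{v}]$. (f) If the vertex $w$ of $G$ is unmarked or marked $r$ then $[G]=[G_{cru}^{w}]$.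
   Context: A marked graph is a finite undirected graph $G$ without multiple edges, in which each vertex may be looped or unlooped, each vertex is either unmarked or carries one of the marks $r,c,cr,u,ur$, together with a number $\phi\ge 0$ of free loops (extra components with no vertices or edges). ''Adjacent'' and ''neighbor'' refer to distinct vertices; a vertex is isolated if it has no neighbors (it may be looped). $G-v$ is obtained by deleting the vertex $v$ and keeping everything else, including free loops. Marked local complement: for $v\in V(G)$, $G_{cru}^v$ is obtained from $G$ by making exactly these changes. (i) The mark of $v$ changes by unmarked $\leftrightarrow u$, $r\leftrightarrow ur$, $c\leftrightarrow cr$. (ii) The mark of each neighbor of $v$ changes by unmarked $\leftrightarrow r$, $c\leftrightarrow ur$, $u\leftrightarrow cr$. (iii) For any two distinct neighbors $x,y$ of $v$, the adjacency between $x$ and $y$ is toggled. Loops and free loops are not changed. Bracket: let $V(G)=\{v_1,\dots,v_n\}$. The Boolean adjacency matrix $\mathcal{A}(G)$ is the $n\times n$ matrix over $GF(2)$ with $(i,j)$ entry ($i\neq j$) equal to $1$ iff $v_i,v_j$ are adjacent, and $(i,i)$ entry equal to $1$ iff $v_i$ is looped. For $T\subseteq V(G)$, $\Delta_T$ is the diagonal matrix over $GF(2)$ whose $i$-th diagonal entry is $1$ iff either $v_i\in T$ and the mark of $v_i$ does not involve the letter $r$, or $v_i\notin T$ and the mark of $v_i$ involves $r$ (being unmarked counts as not involving $r$). $\mathcal{A}(G)_T$ is the submatrix of $\mathcal{A}(G)+\Delta_T$ obtained by removing the $i$-th row and column whenever either $v_i$ is marked $c$ or $cr$ and $(\mathcal{A}(G)+\Delta_T)_{ii}=0$,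 or $v_i$ is marked $u$ or $ur$ and $(\mathcal{A}(G)+\Delta_T)_{ii}=1$. Then $$[G]=d^{\phi}\sum_{T\subseteq V(G)}A^{n-|T|}B^{|T|}d^{\nu(\mathcal{A}(G)_T)},$$ where $\nu$ denotes $GF(2)$-nullity (the empty matrix has nullity $0$). *)

(* Defs.v *)
From mathcomp Require Import all_boot all_order all_algebra.
From mathcomp Require Import mpoly.
Set Implicit Arguments.
Unset Strict Implicit.
Unset Printing Implicit Defensive.
Import GRing.Theory.
Local Open Scope ring_scope.

Variant vmark := Unmarked | MarkR | MarkC | MarkCR | MarkU | MarkUR.

Definition involves_r (m : vmark) : bool :=
  match m with MarkR | MarkCR | MarkUR => true | _ => false end.
Definition c_or_cr (m : vmark) : bool :=
  match m with MarkC | MarkCR => true | _ => false end.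
Definition u_or_ur (m : vmark) : bool :=
  match m with MarkU | MarkUR => true | _ => false end.
Definition unmarked_or_r (m : vmark) : bool :=
  match m with Unmarked | MarkR => true | _ => false end.

(* Adjacency relates distinct vertices only; loops are recorded separately. *)
Record mgraph := MGraph {
  vertex : finType;
  adj : rel vertex;
  adj_sym : ssrbool.symmetric adj;
  adj_irr : irreflexive adj;
  looped : pred vertex;
  mark : vertex -> vmark;
  free_loops : nat
}.

Definition isolated (G : mgraph) (v : vertex G) : Prop :=
  forall x : vertex G, ~~ adj v x.

Section Operations.
Variable G : mgraph.

Section Delete.
Variable v : vertex G.

Definition del_vertex_type : finType := {x : vertex G | x != v}.
Definition del_adj : rel del_vertex_type := fun x y => adj (val x) (val y).

Lemma del_adj_sym : ssrbool.symmetric del_adj.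
Proof. by move=> x y; rewrite /del_adj adj_sym. Qed.
Lemma del_adj_irr : irreflexive del_adj.
Proof. by move=> x; rewrite /del_adj adj_irr. Qed.

Definition del_vertex : mgraph :=
  MGraph del_adj_sym del_adj_irr (fun x => looped (val x))
         (fun x => mark (val x)) (free_loops G).
End Delete.

Definition del_free_loop : mgraph :=
  MGraph (@adj_sym G) (@adj_irr G) (@looped G) (@mark G) (free_loops G).-1.

Definition lc_mark_center (m : vmark) : vmark :=
  match m with
  | Unmarked => MarkU  | MarkU => Unmarked
  | MarkR    => MarkUR | MarkUR => MarkR
  | MarkC    => MarkCR | MarkCR => MarkC
  end.

Definition lc_mark_neighbor (m : vmark) : vmark :=
  match m with
  | Unmarked => MarkR  | MarkR => Unmarked
  | MarkC    => MarkUR | MarkUR => MarkC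
  | MarkU    => MarkCR | MarkCR => MarkU
  end.

Section LocalComplement.
Variable v : vertex G.

Definition lc_adj : rel (vertex G) :=
  fun x y => adj x y (+) [&& x != y, adj v x & adj v y].

Lemma lc_adj_sym : ssrbool.symmetric lc_adj.
Proof. by move=> x y; rewrite /lc_adj adj_sym eq_sym [adj v x && _]andbC. Qed.
Lemma lc_adj_irr : irreflexive lc_adj.
Proof. by move=> x; rewrite /lc_adj adj_irr eqxx. Qed.

Definition lc_mark (x : vertex G) : vmark :=
  if x == v then lc_mark_center (mark x)
  else if adj v x then lc_mark_neighbor (mark x)
  else mark x.

(* The marked local complement $G_{cru}^v$. *)
Definition mlc : mgraph :=
  MGraph lc_adj_sym lc_adj_irr (@looped G) lc_mark (free_loops G).
End LocalComplement.

End Operations.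

Section OneVertex.
Variables (m : vmark) (l : bool).
Definition one_adj : rel unit := fun _ _ => false.
Lemma one_adj_sym : ssrbool.symmetric one_adj. Proof. by []. Qed.
Lemma one_adj_irr : irreflexive one_adj. Proof. by []. Qed.
Definition one_vertex : mgraph :=
  MGraph one_adj_sym one_adj_irr (fun _ => l) (fun _ => m) 0%N.
End OneVertex.

Definition ZABd := {mpoly int[3]}.
Definition varA : ZABd := 'X_(@Ordinal 3 0 isT).
Definition varB : ZABd := 'X_(@Ordinal 3 1 isT).
Definition vard : ZABd := 'X_(@Ordinal 3 2 isT).

Section Bracket.
Variable G : mgraph.
Let n := #|vertex G|.

(* The vertices are numbered by enum_val : 'I_n -> vertex G. *)
Definition adj_mx : 'M['F_2]_n :=
  \matrix_(i, j)
    (if i == j then looped (enum_val i)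
     else adj (enum_val i) (enum_val j))%:R.

Variable T : {set vertex G}.

Definition delta_entry (v : vertex G) : bool :=
  (v \in T) && ~~ involves_r (mark v) || (v \notin T) && involves_r (mark v).

Definition Delta_mx : 'M['F_2]_n :=
  diag_mx (\row_i (delta_entry (enum_val i))%:R).

Definition removed (i : 'I_n) : bool :=
  let a := (adj_mx + Delta_mx) i i in
  c_or_cr (mark (enum_val i)) && (a == 0)
  || u_or_ur (mark (enum_val i)) && (a == 1).

Definition kept : {set 'I_n} := [set i | ~~ removed i].

Definition adj_mx_T : 'M['F_2]_#|kept| :=
  mxsub (@enum_val _ (mem kept)) (@enum_val _ (mem kept)) (adj_mx + Delta_mx).

End Bracket.

(* For a square matrix the row kernel and the column kernel have the same
   dimension. *)
Definition nullity (k : nat) (M : 'M['F_2]_k) : nat := \rank (kermx M).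

Definition bracket (G : mgraph) : ZABd :=
  vard ^+ free_loops G *
  \sum_(T : {set vertex G})
     varA ^+ (#|vertex G| - #|T|) * varB ^+ #|T| * vard ^+ nullity (adj_mx_T T).

Definition one_vertex_value (m : vmark) (l : bool) : ZABd :=
  match m, l with
  | Unmarked, false | MarkR, true | MarkU, false | MarkUR, true =>
      varA * vard + varB
  | Unmarked, true | MarkR, false | MarkU, true | MarkUR, false =>
      varA + varB * vard
  | MarkC, false | MarkCR, true | MarkC, true | MarkCR, false =>
      varA + varB
  end.

(* F is not assumed to be invariant under
   isomorphism; the two base rules therefore range over all graphs with no
   vertex, resp. one vertex, whatever their vertex type. *)
Record bracket_rules (F : mgraph -> ZABd) : Prop := BracketRules {
  rule_empty : forall G : mgraph,
    #|vertex G| = 0%N -> free_loops G = 0%N -> F G = 1;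
  rule_one_vertex : forall (G : mgraph) (v : vertex G),
    #|vertex G| = 1%N -> free_loops G = 0%N ->
    F G = one_vertex_value (mark v) (looped v);
  rule_free_loop : forall G : mgraph,
    (0 < free_loops G)%N -> F G = vard * F (del_free_loop G);
  rule_isolated : forall (G : mgraph) (v : vertex G),
    isolated v ->
    F G = F (one_vertex (mark v) (looped v)) * F (del_vertex v);
  rule_c : forall (G : mgraph) (v : vertex G),
    (~~ looped v /\ mark v = MarkC) \/ (looped v /\ mark v = MarkCR) ->
    F G = varA * F (del_vertex v) + varB * F (@del_vertex (mlc v) v);
  rule_cr : forall (G : mgraph) (v : vertex G),
    (looped v /\ mark v = MarkC) \/ (~~ looped v /\ mark v = MarkCR) ->
    F G = varB * F (del_vertex v) + varA * F (@del_vertex (mlc v) v);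
  rule_u_neighbor : forall (G : mgraph) (v x : vertex G),
    adj v x -> u_or_ur (mark x) -> F G = F (mlc v);
  rule_unmarked_or_r : forall (G : mgraph) (w : vertex G),
    unmarked_or_r (mark w) -> F G = F (mlc w)
}.

(* Main.v *)
(* Nullities are counted as kernels: [2 ^ nullity (adj_mx_T T)] is the number of
   vectors on the vertex set that are supported on the kept vertices and orthogonal
   to their columns. This makes deletion a reindexing and local complementation
   a pivot: the marked local complement preserves the summand of every [T],
   for every vertex [v], which gives (e) and (f). Rules (c) and (d) follow by
   splitting the sum according to whether [v] belongs to [T].
   For uniqueness, at most two local complements (at one end of an edge, then
   at the other) give one end of the edge the mark c or cr, and it can be removed
   by (d). *)
From mathcomp Require Import all_boot all_order all_algebra.
From mathcomp Require Import mxabelem mpoly.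
Require Import Defs.
Set Implicit Arguments.
Unset Strict Implicit.
Unset Printing Implicit Defensive.
Import GRing.Theory.
Local Open Scope ring_scope.

(** * Arithmetic in GF(2) *)

Lemma F2_eq01 (a : 'F_2) : (a == 0) || (a == 1).
Proof. by case: a => -[|[|]]. Qed.

Lemma F2_addrr (a : 'F_2) : a + a = 0.
Proof. by apply: addrr_pchar2; rewrite pchar_Fp. Qed.

Lemma F2_oppr (a : 'F_2) : - a = a.
Proof. by apply/esym/eqP; rewrite -addr_eq0 F2_addrr. Qed.

Lemma F2_addb (a b : bool) : (a (+) b)%:R = a%:R + b%:R :> 'F_2.
Proof. by case: a b => [] []; rewrite ?addr0 ?add0r ?F2_addrr. Qed.

(** * Counting kernels of principal submatrices over GF(2) *)

Section KerSet.
Variable V : finType.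
Implicit Types (m : V -> V -> 'F_2) (S : pred V) (x : {ffun V -> 'F_2}) (v : V).

(** Left kernel of the principal submatrix of [m] on [S], its vectors extended by zero. The ambient
    index type stays the same while [S] varies. *)
Definition ker_set m S : {set {ffun V -> 'F_2}} :=
  [set x : {ffun V -> 'F_2} | [forall i, ~~ S i ==> (x i == 0)] &&
           [forall j, S j ==> (\sum_i x i * m i j == 0)]].

Lemma ker_setP m S x :
  reflect ((forall i, ~~ S i -> x i = 0) /\
           (forall j, S j -> \sum_i x i * m i j = 0))
          (x \in ker_set m S).
Proof.
rewrite inE; apply: (iffP andP) => -[H1 H2]; split.
- by move=> i Si; apply/eqP; apply: (implyP (forallP H1 i)).
- by move=> i Si; apply/eqP; apply: (implyP (forallP H2 i)).
- by apply/forallP => i; apply/implyP => /H1 ->.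
- by apply/forallP => i; apply/implyP => /H2 ->.
Qed.

Lemma eq_ker_set m m' S S' :
  S =1 S' -> (forall i j, S i -> S j -> m i j = m' i j) ->
  ker_set m S = ker_set m' S'.
Proof.
move=> eqS eqm; apply/setP => x.
suff sub m1 m2 S1 S2 : S1 =1 S2 ->
    (forall i j, S1 i -> S1 j -> m1 i j = m2 i j) ->
    x \in ker_set m1 S1 -> x \in ker_set m2 S2.
  by apply/idP/idP; apply: sub => // i j; rewrite -!eqS => Si Sj; rewrite eqm.
move=> eq12 eqm12 /ker_setP[H1 H2]; apply/ker_setP; split=> [i|j].
  by rewrite -eq12; apply: H1.
rewrite -eq12 => Sj; rewrite -[RHS](H2 j Sj); apply: eq_bigr => i _.
by case: (boolP (S1 i)) => [Si|/H1->]; rewrite ?mul0r ?eqm12.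
Qed.

(** Adds [m v j] times column [v] to each column [j]. If [m v v = 1], the entries off row and column
    [v] form the Schur complement of that entry, signs being immaterial in characteristic 2. *)
Definition pivot m v : V -> V -> 'F_2 := fun i j => m i j + m i v * m v j.

Lemma sum_pivot m v x j :
  \sum_i x i * pivot m v i j =
  \sum_i x i * m i j + (\sum_i x i * m i v) * m v j.
Proof.
by rewrite mulr_suml -big_split /=; apply: eq_bigr => i _; rewrite mulrDr mulrA.
Qed.

(** As [m v v = 0], column [v] is itself unchanged, so both systems contain the equation at [v]; it
    annihilates the correction term of [sum_pivot]. *)
Lemma ker_set_pivot0 m S v :
  S v -> m v v = 0 -> ker_set (pivot m v) S = ker_set m S.
Proof.
move=> Sv mvv; apply/setP => x; apply/ker_setP/ker_setP => -[H1 H2]; split=> // j Sj.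
- have := H2 j Sj; rewrite sum_pivot.
  have := H2 v Sv; rewrite sum_pivot mvv mulr0 addr0 => ->.
  by rewrite mul0r addr0.
- by rewrite sum_pivot !H2 // mul0r addr0.
Qed.

(* Gaussian elimination: the column equation at [v] expresses [x v] through the
   other entries of [x]. *)
Lemma card_ker_set_pivot1 m S v :
  S v -> m v v = 1 ->
  #|ker_set m S| = #|ker_set (pivot m v) [pred i | S i & i != v]|.
Proof.
move=> Sv mvv.
pose g (x : {ffun V -> 'F_2}) := [ffun i => if i == v then 0 else x i].
have sumE x j : \sum_i x i * m i j = x v * m v j + \sum_i g x i * m i j.
  rewrite (bigD1 v) //= [in RHS](bigD1 v) //= ffunE eqxx mul0r add0r.
  by congr (_ + _); apply: eq_bigr => i /negPf iv; rewrite ffunE iv.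
have xvE x : x \in ker_set m S -> x v = \sum_i g x i * m i v.
  move=> /ker_setP[_ /(_ v Sv)]; rewrite sumE mvv mulr1 => /eqP.
  by rewrite addr_eq0 F2_oppr => /eqP.
suff -> : ker_set (pivot m v) [pred i | S i & i != v] = g @: ker_set m S.
  rewrite card_in_imset // => x y Kx Ky eqg; apply/ffunP => i.
  have [->|iv] := eqVneq i v; first by rewrite !xvE ?eqg.
  by move/ffunP/(_ i): eqg; rewrite !ffunE (negPf iv).
apply/setP => y; apply/ker_setP/imsetP => [[H1 H2]|[x Kx ->]].
  have yv : y v = 0 by apply: H1; rewrite /= eqxx andbF.
  pose x := [ffun i => if i == v then \sum_i y i * m i v else y i].
  have gx : g x = y.
    by apply/ffunP => i; rewrite !ffunE; case: eqP => // ->.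
  exists x => //; apply/ker_setP; split=> [i nSi|j Sj].
    have iv : i != v by apply: contraNneq nSi => ->.
    by rewrite ffunE (negPf iv) H1 //= (negPf nSi).
  rewrite sumE gx ffunE eqxx; have [->|jv] := eqVneq j v.
    by rewrite mvv mulr1 F2_addrr.
  by rewrite addrC -sum_pivot H2 //= Sj.
have /ker_setP[H1 H2] := Kx; split=> [i|j /= /andP[Sj jv]].
  by rewrite ffunE negb_and negbK; case: eqP => //= _; rewrite orbF => /H1.
by rewrite sum_pivot -xvE // addrC -sumE H2.
Qed.

(** The coordinate at [v] is free: the kernel is the disjoint union of [K], where it is 0, and
    [g @: K], where it is 1. *)
Lemma card_ker_set_isolated0 m S v :
  S v -> (forall i, m i v = 0) -> (forall i, m v i = 0) ->
  #|ker_set m S| = (2 * #|ker_set m [pred i | S i & i != v]|)%N.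
Proof.
move=> Sv miv mvi.
pose K := ker_set m [pred i | S i & i != v].
pose g (x : {ffun V -> 'F_2}) := [ffun i => if i == v then 1 else x i] : {ffun V -> 'F_2}.
have sum_eq x (y : {ffun V -> 'F_2}) j : (forall i, i != v -> x i = y i) ->
    \sum_i x i * m i j = \sum_i y i * m i j :> 'F_2.
  move=> exy; rewrite (bigD1 v) //= [in RHS](bigD1 v) //= mvi !mulr0.
  by congr (_ + _); apply: eq_bigr => i /exy ->.
have Kv x : x \in K -> x v = 0 by case/ker_setP => + _; apply; rewrite /= eqxx andbF.
have KS x (y : {ffun V -> 'F_2}) :
    x \in K -> (forall i, i != v -> y i = x i) -> y \in ker_set m S.
  move=> /ker_setP[H1 H2] exy; apply/ker_setP; split=> [i nSi|j Sj].
    have iv : i != v by apply: contraNneq nSi => ->.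
    by rewrite exy // H1 //= (negPf nSi).
  rewrite (sum_eq y x j exy); have [->|jv] := eqVneq j v; last by rewrite H2 //= Sj.
  by rewrite big1 // => i _; rewrite miv mulr0.
have SK x (y : {ffun V -> 'F_2}) :
    x \in ker_set m S -> y v = 0 -> (forall i, i != v -> y i = x i) -> y \in K.
  move=> /ker_setP[H1 H2] yv exy; apply/ker_setP; split=> [i|j /= /andP[Sj jv]].
    by have [->//|iv] := eqVneq i v; rewrite /= iv andbT exy //; apply: H1.
  by rewrite (sum_eq y x j exy) H2.
have -> : ker_set m S = K :|: g @: K.
  apply/setP => x; rewrite in_setU; apply/idP/orP => [Kx|[Kx|/imsetP[y Ky ->]]].
  - case/orP: (F2_eq01 (x v)) => /eqP xv; first by left; apply: (SK x).
    right; apply/imsetP; exists [ffun i => if i == v then 0 else x i].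
      by apply: (SK x) => // [|i /negPf iv]; rewrite ffunE ?eqxx ?iv.
    by apply/ffunP => i; rewrite !ffunE; case: eqP => // ->.
  - exact: (KS x).
  - by apply: (KS y) => // i /negPf iv; rewrite ffunE iv.
rewrite cardsU disjoint_setI0 ?cards0 ?subn0 ?card_in_imset.
- by rewrite mul2n addnn.
- move=> x y Kx Ky /ffunP eqg; apply/ffunP => i.
  have [->|/negPf iv] := eqVneq i v; first by rewrite !Kv.
  by move/(_ i): eqg; rewrite !ffunE iv.
- rewrite disjoint_subset; apply/subsetP => x Kx; rewrite inE.
  apply/negP => /imsetP[y _ xE]; have := Kv x Kx.
  by rewrite xE ffunE eqxx.
Qed.

End KerSet.

(** Kernel vectors vanish off [S], hence off the range of [f], so pulling back along [f] loses
    nothing. It serves both for enumerations and for the inclusion of the vertices of [G - v]. *)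
Lemma card_ker_set_reindex (I V : finType) (f : I -> V) (m : V -> V -> 'F_2)
    (S : pred V) :
  injective f -> (forall v, S v -> v \in codom f) ->
  #|ker_set m S| = #|ker_set (fun i j => m (f i) (f j)) (S \o f)|.
Proof.
move=> injf Sf.
pose g (x : {ffun V -> 'F_2}) := [ffun i => x (f i)].
have sumE x j : (forall v, v \notin codom f -> x v = 0) ->
    \sum_v x v * m v j = \sum_i x (f i) * m (f i) j.
  move=> x0; rewrite (bigID (mem (codom f))) /= addrC big1 ?add0r; last first.
    by move=> v /x0 ->; rewrite mul0r.
  transitivity (\sum_(v in f @: [set: I]) x v * m v j).
    apply: eq_bigl => v.
    by apply/codomP/imsetP => [[i ->]|[i _ ->]]; exists i.
  rewrite big_imset /=; last by move=> i i' _ _ /injf.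
  by apply: eq_bigl => i; rewrite in_setT.
have supp x : x \in ker_set m S -> forall v, v \notin codom f -> x v = 0.
  by move=> /ker_setP[H _] v vf; apply: H; apply: contra vf; apply: Sf.
suff -> : ker_set (fun i j => m (f i) (f j)) (S \o f) = g @: ker_set m S.
  rewrite card_in_imset // => x y /supp x0 /supp y0 /ffunP eqg.
  apply/ffunP => v; have [/codomP[i ->]|vf] := boolP (v \in codom f).
    by move/(_ i): eqg; rewrite !ffunE.
  by rewrite x0 ?y0.
apply/setP => y; apply/ker_setP/imsetP => [[H1 H2]|[x Kx ->]].
  pose x := [ffun v => if [pick i | f i == v] is Some i then y i else 0]
    : {ffun V -> 'F_2}.
  have xf i : x (f i) = y i.
    rewrite ffunE; case: pickP => [i' /eqP/injf -> //|/(_ i)].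
    by rewrite eqxx.
  have x0 v : v \notin codom f -> x v = 0.
    rewrite ffunE; case: pickP => // i /eqP <-.
    by rewrite codom_f.
  exists x; last by apply/ffunP => i; rewrite ffunE xf.
  apply/ker_setP; split=> [v nSv|_ /[dup] /Sf/codomP[j ->] Sj].
    have [/codomP[i vE]|/x0//] := boolP (v \in codom f).
    by rewrite vE xf H1 //= -vE.
  rewrite sumE // -[RHS](H2 j Sj); apply: eq_bigr => i _.
  by rewrite xf.
have /ker_setP[H1 H2] := Kx; split=> [i nSi|j Sj]; first by rewrite ffunE H1.
rewrite -[RHS](H2 _ Sj) sumE; last exact: supp.
by apply: eq_bigr => i _; rewrite ffunE.
Qed.

Lemma expn2_nullity (k : nat) (M : 'M['F_2]_k) :
  (2 ^ nullity M)%N = #|ker_set M predT|.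
Proof.
rewrite /nullity -{1}(card_Fp (isT : prime 2)) -card_rowg.
pose g (x : {ffun 'I_k -> 'F_2}) : 'rV['F_2]_k := \row_i x i.
have injg : injective g.
  by move=> x y /rowP eqg; apply/ffunP => i; move/(_ i): eqg; rewrite !mxE.
rewrite -(card_imset _ injg); apply: eq_card => u.
rewrite inE sub_kermx; apply/eqP/imsetP => [/rowP uM|[x /ker_setP[_ H2] ->]].
  exists [ffun i => u 0 i]; last by apply/rowP => i; rewrite !mxE ffunE.
  apply/ker_setP; split=> // j _; have := uM j; rewrite !mxE => uMj.
  by rewrite -[RHS]uMj; apply: eq_bigr => i _; rewrite ffunE.
apply/rowP => j; rewrite !mxE -[RHS](H2 j isT).
by apply: eq_bigr => i _; rewrite mxE.
Qed.

(** * The summand of a subset [T], indexed by vertices *)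

Section BracketTerm.
Variables (G : mgraph) (T : {set vertex G}).
Implicit Types x y : vertex G.

Definition bdiag x : bool := looped x (+) delta_entry T x.

Definition bmx x y : 'F_2 := (if x == y then bdiag x else adj x y)%:R.

Definition bkept x : bool :=
  ~~ (c_or_cr (mark x) && ~~ bdiag x || u_or_ur (mark x) && bdiag x).

Lemma bmx_diag x : bmx x x = (bdiag x)%:R.
Proof. by rewrite /bmx eqxx. Qed.

Lemma expn2_nullity_adj_mx_T :
  (2 ^ nullity (adj_mx_T T))%N = #|ker_set bmx bkept|.
Proof.
have mxE' i j : (adj_mx G + Delta_mx T) i j = bmx (enum_val i) (enum_val j).
  rewrite !mxE /bmx /bdiag (inj_eq enum_val_inj).
  by case: eqP => _; rewrite ?mulr1n ?mulr0n ?addr0 // F2_addb.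
have keptE i : (i \in kept T) = bkept (enum_val i).
  rewrite inE /removed /bkept mxE' bmx_diag.
  by case: bdiag.
(* The two numberings, of kept indices and of vertices, compose to an injection whose range is the
   set of kept vertices. *)
pose f (i : 'I_#|kept T|) : vertex G := enum_val (enum_val i).
rewrite expn2_nullity (card_ker_set_reindex (f := f)).
- congr #|pred_of_set _|; apply: eq_ker_set => [i|i j _ _].
    by rewrite /= /f -keptE enum_valP.
  by rewrite mxE mxE'.
- by move=> i j /enum_val_inj/enum_val_inj.
- move=> v Kv; have Kr : enum_rank v \in kept T by rewrite keptE enum_rankK.
  by apply/codomP; exists (enum_rank_in Kr (enum_rank v));
    rewrite /f enum_rankK_in ?enum_rankK.
Qed.

End BracketTerm.

(** * Local complementation as a pivot *)

Section LocalComplementTerm.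
Variables (G : mgraph) (v : vertex G) (T : {set vertex G}).
Let H : mgraph := mlc v.
Implicit Types x y : vertex G.

(** Each mark change at a neighbor toggles the letter r, so the diagonal entry flips there. *)
Lemma mlc_bdiag x : x != v -> @bdiag H T x = bdiag T x (+) adj v x.
Proof.
move=> /negPf xv; rewrite /bdiag /delta_entry /= /lc_mark xv.
by case: adj; case: mark; case: looped; case: (x \in T).
Qed.

(** At the center only the exchange of c and cr affects the letter r. *)
Lemma mlc_bdiag_center : @bdiag H T v = bdiag T v (+) c_or_cr (mark v).
Proof.
rewrite /bdiag /delta_entry /= /lc_mark eqxx.
by case: mark; case: looped; case: (v \in T).
Qed.

(** At a neighbor the diagonal entry flips while the classes c/cr and u/ur are exchanged, and these
    two changes cancel in the removal condition. *)
Lemma mlc_bkept x : x != v -> @bkept H T x = bkept T x.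
Proof.
move=> xv; rewrite /bkept mlc_bdiag //= /lc_mark (negPf xv).
by case: bdiag; case: adj; case: mark.
Qed.

Lemma mlc_bkept_center :
  @bkept H T v = if unmarked_or_r (mark v) then ~~ bdiag T v
                 else if c_or_cr (mark v) then ~~ bdiag T v else true.
Proof.
rewrite /bkept mlc_bdiag_center /= /lc_mark eqxx.
by case: mark; case: bdiag.
Qed.

Lemma bmx_center x : x != v -> bmx T x v = (adj v x)%:R /\ bmx T v x = (adj v x)%:R.
Proof. by move=> /negPf xv; rewrite /bmx (eq_sym v x) xv (adj_sym x v). Qed.

(** Toggling edges between neighbors of [v], together with the diagonal flips at neighbors, adds the
    product of column [v] and row [v]. *)
Lemma mlc_bmx x y : x != v -> y != v -> @bmx H T x y = pivot (bmx T) v x y.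
Proof.
move=> xv yv; rewrite /pivot (bmx_center xv).1 (bmx_center yv).2.
rewrite -natrM mulnb -F2_addb /bmx mlc_bdiag //= /lc_adj.
by have [<-|] := eqVneq x y; rewrite //= andbb.
Qed.

Lemma mlc_bmx_center x :
  x != v -> @bmx H T x v = bmx T x v /\ @bmx H T v x = bmx T v x.
Proof.
move=> /negPf xv; rewrite /bmx (eq_sym v x) xv /= /lc_adj adj_irr.
by rewrite !andbF !addbF.
Qed.

(* The same subset [T] contributes equally to both brackets: where [v] is kept
   with diagonal entry [1] in one graph it is removed in the other, which is the
   outcome of pivoting on [v]; otherwise it is kept with diagonal entry [0] in
   both graphs, and the matrices differ by row operations. *)
Lemma nullity_mlc : nullity (@adj_mx_T H T) = nullity (adj_mx_T T).
Proof.
apply: (@expnI 2) => //; rewrite !expn2_nullity_adj_mx_T.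
(* Off the diagonal, row and column [v] agree in both graphs, so pivoting twice adds the same
   product twice and restores the matrix. This lets the second case exchange the roles of the
   graphs. *)
have mlc_pivot x y : x != v -> y != v -> bmx T x y = pivot (@bmx H T) v x y.
  move=> xv yv; rewrite /pivot mlc_bmx // (mlc_bmx_center xv).1 (mlc_bmx_center yv).2.
  by rewrite /pivot -addrA F2_addrr addr0.
have [/andP[Kv dv]|nKv] := boolP (bkept T v && bdiag T v).
  have nKv' : @bkept H T v = false.
    by rewrite mlc_bkept_center dv; move: Kv; rewrite /bkept dv; case: mark.
  rewrite [RHS](card_ker_set_pivot1 Kv) ?bmx_diag ?dv //.
  congr #|pred_of_set _|; apply: eq_ker_set => [x|x y].
    by have [->|xv] := eqVneq x v; rewrite /= ?nKv' ?eqxx ?andbF // mlc_bkept ?xv ?andbT.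
  have [->|xv] := eqVneq x v; first by rewrite nKv'.
  have [->|yv] := eqVneq y v; first by rewrite nKv'.
  by rewrite mlc_bmx.
have [/andP[Kv dv]|nKv'] := boolP (@bkept H T v && @bdiag H T v).
  have nKv' : bkept T v = false.
    by move: nKv dv; rewrite mlc_bdiag_center /bkept; case: bdiag; case: mark.
  rewrite [LHS](card_ker_set_pivot1 Kv) ?bmx_diag ?dv //.
  congr #|pred_of_set _|; apply: eq_ker_set => [x|x y] /=.
    by have [->|xv] := eqVneq x v; rewrite ?nKv' ?andbF // mlc_bkept ?andbT.
  by move=> /andP[_ xv] /andP[_ yv]; rewrite mlc_pivot.
have [Kv dv] : bkept T v /\ bdiag T v = false.
  move: nKv nKv'; rewrite mlc_bkept_center mlc_bdiag_center /bkept.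
  by case: bdiag; case: mark.
rewrite -(ker_set_pivot0 Kv) ?bmx_diag ?dv //.
congr #|pred_of_set _|; apply: eq_ker_set => [x|x y _ _].
  have [->|xv] := eqVneq x v; last exact: mlc_bkept.
  by rewrite Kv; move: Kv; rewrite mlc_bkept_center /bkept dv; case: mark.
have dv' : @bdiag H T v = false.
  by move: nKv nKv'; rewrite mlc_bkept_center mlc_bdiag_center /bkept dv; case: mark.
have [->|xv] := eqVneq x v.
  rewrite /pivot bmx_diag dv mul0r addr0.
  by have [->|yv] := eqVneq y v; rewrite ?bmx_diag ?dv ?dv' ?(mlc_bmx_center yv).2.
have [->|yv] := eqVneq y v; last by rewrite mlc_bmx.
by rewrite /pivot bmx_diag dv mulr0 addr0 (mlc_bmx_center xv).1.
Qed.

End LocalComplementTerm.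

Lemma bracket_mlc (G : mgraph) (v : vertex G) : bracket (mlc v) = bracket G.
Proof.
rewrite /bracket; congr (_ * _); apply: eq_bigr => T _.
by rewrite nullity_mlc.
Qed.

(** * Deleting a vertex *)

Section DeleteTerm.
Variables (G : mgraph) (v : vertex G).
Let D : mgraph := del_vertex v.
Implicit Types (T : {set vertex G}) (U : {set vertex D}).

Definition del_lift U : {set vertex G} := [set val x | x in U].

Lemma val_del_lift U (x : vertex D) : (val x \in del_lift U) = (x \in U).
Proof. by rewrite mem_imset //; apply: val_inj. Qed.

Lemma notin_del_lift U : v \notin del_lift U.
Proof. by apply/imsetP => -[x _ vE]; have := valP x; rewrite -vE eqxx. Qed.

(** Every subset of the vertices of [G] restricts to a unique [U], and each [U] has two extensions,
    without and with [v]. *)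
Lemma big_set_del (R : nmodType) (f : {set vertex G} -> R) :
  \sum_T f T = \sum_U (f (del_lift U) + f (v |: del_lift U)).
Proof.
pose res T : {set vertex D} := [set x | val x \in T].
have liftK : cancel del_lift res.
  by move=> U; apply/setP => x; rewrite inE val_del_lift.
have resK T : v \notin T -> del_lift (res T) = T.
  move=> vT; apply/setP => x; have [->|xv] := eqVneq x v.
    by rewrite (negPf vT) (negPf (notin_del_lift _)).
  by rewrite -[x]/(val (Sub x xv : vertex D)) val_del_lift inE.
rewrite (bigID (fun T => v \in T)) /= addrC big_split /=; congr (_ + _).
  rewrite (reindex_onto del_lift res) //=; apply: eq_bigl => U.
  by rewrite notin_del_lift liftK eqxx.
rewrite (reindex_onto (fun U => v |: del_lift U) (fun T => res (T :\ v))) /=.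
  by apply: eq_bigl => U; rewrite setU11 setU1K ?notin_del_lift // liftK eqxx.
by move=> T vT; rewrite resK ?setD1K // !inE eqxx.
Qed.

Lemma card_del_lift U : #|del_lift U| = #|U|.
Proof. by rewrite card_imset //; apply: val_inj. Qed.

Lemma card_setU1_del_lift U : #|v |: del_lift U| = #|U|.+1.
Proof. by rewrite cardsU1 notin_del_lift card_del_lift. Qed.

Lemma card_vertex_del : #|vertex G| = #|vertex D|.+1.
Proof. by rewrite /= card_sig -(cardC (pred1 v)) card1 add1n. Qed.

Lemma bracket_del :
  bracket G = vard ^+ free_loops G *
    \sum_(U : {set vertex D})
           (varA * (varA ^+ (#|vertex D| - #|U|) * varB ^+ #|U| *
                      vard ^+ nullity (adj_mx_T (del_lift U))) +
            varB * (varA ^+ (#|vertex D| - #|U|) * varB ^+ #|U| *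
                      vard ^+ nullity (adj_mx_T (v |: del_lift U)))).
Proof.
rewrite /bracket big_set_del; congr (_ * _); apply: eq_bigr => U _.
(* This bound makes the truncated subtraction below exact, yielding the extra factor [varA] when [v]
   is outside [T]. *)
have leU : (#|U| <= #|vertex D|)%N by apply: max_card.
rewrite card_del_lift card_setU1_del_lift.
have -> : (#|vertex G| - #|U| = (#|vertex D| - #|U|).+1)%N.
  by rewrite card_vertex_del subSn.
have -> : (#|vertex G| - #|U|.+1 = #|vertex D| - #|U|)%N.
  by rewrite card_vertex_del subSS.
by rewrite !exprS -!mulrA; congr (_ + _); rewrite mulrCA.
Qed.

Section Subset.
Variables (T : {set vertex G}) (U : {set vertex D}).
(** Both extensions of [U] satisfy this, which lets one argument treat them together. *)
Hypothesis TU : forall x : vertex D, (val x \in T) = (x \in U).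

Lemma del_bdiag (x : vertex D) : bdiag T (val x) = bdiag U x.
Proof. by rewrite /bdiag /delta_entry TU. Qed.

(** [S] is a parameter so that the count also applies when [v] is kept for [T] but has been
    eliminated by hand, as for an isolated vertex. *)
Lemma card_ker_set_del (S : pred (vertex G)) :
  ~~ S v -> (forall x, x != v -> S x = bkept T x) ->
  #|ker_set (bmx T) S| = (2 ^ nullity (adj_mx_T U))%N.
Proof.
move=> nSv SE; rewrite expn2_nullity_adj_mx_T.
rewrite (card_ker_set_reindex (f := val : vertex D -> vertex G)).
- congr #|pred_of_set _|; apply: eq_ker_set => [x|x y _ _].
    by rewrite /= SE ?(valP x) // /bkept del_bdiag.
  by rewrite /bmx del_bdiag.
- exact: val_inj.
- move=> x Sx; have xv : x != v by apply: contraNneq nSv => <-.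
  by apply/codomP; exists (Sub x xv).
Qed.

Lemma nullity_del : ~~ bkept T v -> nullity (adj_mx_T T) = nullity (adj_mx_T U).
Proof.
by move=> nKv; apply: (@expnI 2) => //; rewrite expn2_nullity_adj_mx_T card_ker_set_del.
Qed.

(** Row and column [v] vanish off the diagonal. A kept diagonal 0 is a free coordinate, whereas a
    kept diagonal 1 is a pivot that leaves the other entries unchanged. *)
Lemma nullity_isolated :
  isolated v ->
  nullity (adj_mx_T T) = (bkept T v && ~~ bdiag T v + nullity (adj_mx_T U))%N.
Proof.
move=> iso; have [Kv|] := boolP (bkept T v); last exact: nullity_del.
have bmxv x : x != v -> bmx T v x = 0 /\ bmx T x v = 0.
  by move=> xv; rewrite /bmx (eq_sym v x) (negPf xv) (adj_sym x v) (negPf (iso x)).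
apply: (@expnI 2) => //; rewrite expnD expn2_nullity_adj_mx_T.
rewrite -(card_ker_set_del (S := [pred x | bkept T x & x != v])); first last.
- by move=> x /= ->; rewrite andbT.
- by rewrite /= eqxx andbF.
have [dv|dv] := boolP (bdiag T v).
  rewrite mul1n (card_ker_set_pivot1 Kv) ?bmx_diag ?dv //.
  congr #|pred_of_set _|; apply: eq_ker_set => //= x y /andP[_ xv] _.
  by rewrite /pivot (bmxv x xv).2 mul0r addr0.
rewrite (card_ker_set_isolated0 Kv) // => x.
  by have [->|/bmxv[]//] := eqVneq x v; rewrite bmx_diag (negPf dv).
by have [->|/bmxv[]//] := eqVneq x v; rewrite bmx_diag (negPf dv).
Qed.

End Subset.
End DeleteTerm.

(** * Isolated vertices and vertices marked c or cr *)

Section Recursion.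
Variables (G : mgraph) (v : vertex G).

Lemma val_setU1_del_lift (U : {set vertex (del_vertex v)}) (x : vertex (del_vertex v)) :
  (val x \in v |: del_lift U) = (x \in U).
Proof. by rewrite in_setU1 (negPf (valP x)) val_del_lift. Qed.

Lemma bracket_isolated :
  isolated v ->
  bracket G = one_vertex_value (mark v) (looped v) * bracket (del_vertex v).
Proof.
move=> iso; rewrite (bracket_del v) [in RHS]/bracket mulrCA; congr (_ * _).
rewrite mulr_sumr; apply: eq_bigr => U _.
rewrite (nullity_isolated (val_del_lift U) iso).
rewrite (nullity_isolated (val_setU1_del_lift U) iso).
(* Isolates the factor contributed by [v]: [varA] and [varB], each times [vard] to the 0 or 1 that
   [v] adds to the nullity. The marks and loops are then checked case by case. *)
rewrite !exprD !mulrA !(mulrAC _ _ (vard ^+ (_ && _))) -!mulrDl; congr (_ * _ * _ * _).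
rewrite /bkept /bdiag /delta_entry (negPf (notin_del_lift U)) setU11.
by case: (mark v); case: (looped v) => /=; rewrite ?expr0 ?expr1 ?mulr1.
Qed.

(** Here [a] is the diagonal entry at [v] when [v] is outside [T], and [v] is kept iff its entry is
    1, so exactly one extension of each [U] keeps [v]. The other gives the term of [G - v]; the
    keeping one is transported by [nullity_mlc] to the local complement, where [v] is removed. *)
Lemma bracket_c_cr :
  c_or_cr (mark v) ->
  let a := looped v (+) involves_r (mark v) in
  bracket G = (if a then varB else varA) * bracket (del_vertex v) +
              (if a then varA else varB) * bracket (@del_vertex (mlc v) v).
Proof.
move=> cv a.
have bkeptE (T : {set vertex G}) : bkept T v = (v \in T) (+) a.
  rewrite /bkept /bdiag /delta_entry /a; move: cv.
  by case: (mark v); case: (looped v); case: (v \in T).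
have nullity_kept (T : {set vertex G}) (U : {set vertex (del_vertex v)}) :
    (forall x, (val x \in T) = (x \in U)) -> bkept T v ->
    nullity (adj_mx_T T) = nullity (@adj_mx_T (@del_vertex (mlc v) v) U).
  move=> TU Kv; rewrite -(nullity_mlc v); apply: (@nullity_del (mlc v) v T U) => //.
  rewrite mlc_bkept_center; move: Kv cv; rewrite /bkept.
  by case: bdiag; case: mark.
rewrite (bracket_del v) [X in _ * X + _]/bracket [X in _ + _ * X]/bracket.
rewrite !(mulrCA _ (vard ^+ _)) -mulrDr; congr (_ * _).
rewrite !mulr_sumr -big_split; apply: eq_bigr => U _ /=.
move: (bkeptE (del_lift U)) (bkeptE (v |: del_lift U)).
rewrite (negPf (notin_del_lift U)) setU11.
case: (a) => /= [K1 /negbT K2|/negbT K1 K2].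
- rewrite (nullity_kept _ _ (val_del_lift U) K1).
  by rewrite (nullity_del (val_setU1_del_lift U) K2) addrC.
- rewrite (nullity_del (val_del_lift U) K1).
  by rewrite (nullity_kept _ _ (val_setU1_del_lift U) K2).
Qed.

End Recursion.

(** * The bracket satisfies the rules *)

Lemma bracket_empty (G : mgraph) :
  #|vertex G| = 0%N -> free_loops G = 0%N -> bracket G = 1.
Proof.
move=> G0 fl0; have T0 (T : {set vertex G}) : T = set0.
  by apply/eqP; rewrite -cards_eq0 -leqn0 -G0 max_card.
rewrite /bracket (big_pred1 set0) => [|T]; last by rewrite (T0 T) /= eqxx.
suff -> : nullity (adj_mx_T (set0 : {set vertex G})) = 0%N.
  by rewrite fl0 cards0 G0 !expr0 !mulr1.
apply/eqP; rewrite -leqn0; apply: leq_trans (rank_leq_row _) _.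
by rewrite -G0 -[leqRHS]card_ord max_card.
Qed.

Lemma bracket_one_vertex (G : mgraph) (v : vertex G) :
  #|vertex G| = 1%N -> free_loops G = 0%N ->
  bracket G = one_vertex_value (mark v) (looped v).
Proof.
move=> G1 fl0; rewrite (bracket_isolated (v := v)).
  by rewrite bracket_empty ?mulr1 //; apply: succn_inj; rewrite -card_vertex_del.
move=> x; suff -> : x = v by rewrite adj_irr.
by have /fintype_le1P := eq_leq G1; apply.
Qed.

Lemma bracket_free_loop (G : mgraph) :
  (0 < free_loops G)%N -> bracket G = vard * bracket (del_free_loop G).
Proof. by move=> fl; rewrite [in RHS]/bracket mulrA -exprS prednK. Qed.

Lemma bracket_rules_bracket : bracket_rules bracket.
Proof.
split.
- exact: bracket_empty.
- exact: bracket_one_vertex.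
- exact: bracket_free_loop.
- move=> G v iso; rewrite (bracket_isolated iso).
  by rewrite (@bracket_one_vertex (one_vertex _ _) tt) // card_unit.
- move=> G v H; rewrite (bracket_c_cr (v := v)).
    by case: H => -[/= lv ->]; rewrite ?(negPf lv) ?lv.
  by case: H => -[_ ->].
- move=> G v H; rewrite (bracket_c_cr (v := v)).
    by case: H => -[/= lv ->]; rewrite ?(negPf lv) ?lv.
  by case: H => -[_ ->].
- by move=> G v x _ _; rewrite bracket_mlc.
- by move=> G w _; rewrite bracket_mlc.
Qed.

(** * The rules determine the bracket *)

Section Uniqueness.
Variables F1 F2 : mgraph -> ZABd.
Hypotheses (F1P : bracket_rules F1) (F2P : bracket_rules F2).

Lemma bracket_rules_c_cr (G : mgraph) (v : vertex G) :
  c_or_cr (mark v) ->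
  F1 (del_vertex v) = F2 (del_vertex v) ->
  F1 (@del_vertex (mlc v) v) = F2 (@del_vertex (mlc v) v) ->
  F1 G = F2 G.
Proof.
move=> cv E1 E2.
have [H|H] : ((~~ looped v /\ mark v = MarkC) \/ (looped v /\ mark v = MarkCR)) \/
             ((looped v /\ mark v = MarkC) \/ (~~ looped v /\ mark v = MarkCR)).
- by case: (looped v); case: (mark v) cv => // _;
    first [by left; left | by left; right | by right; left | by right; right].
- by rewrite (rule_c F1P H) (rule_c F2P H) E1 E2.
- by rewrite (rule_cr F1P H) (rule_cr F2P H) E1 E2.
Qed.

Lemma bracket_rules_unique (G : mgraph) : F1 G = F2 G.
Proof.
have [n] := ubnP (#|vertex G| + free_loops G); elim: n G => // n IH G.
rewrite ltnS => leG.
(* This and the next claims concern any [H] with the counts of [G], so that they also apply to local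
   complements, which leave the induction measure unchanged. *)
have IHdel (H : mgraph) (v : vertex H) :
    #|vertex H| = #|vertex G| -> free_loops H = free_loops G ->
    F1 (del_vertex v) = F2 (del_vertex v).
  move=> cH fH; apply: IH; apply: leq_trans leG.
  by rewrite -cH -fH (card_vertex_del v) addSn.
have Fc (H : mgraph) (v : vertex H) :
    #|vertex H| = #|vertex G| -> free_loops H = free_loops G ->
    c_or_cr (mark v) -> F1 H = F2 H.
  by move=> cH fH cv; apply: (bracket_rules_c_cr cv); apply: IHdel.
have [fl|] := posnP (free_loops G); last first.
  move=> fl; rewrite (rule_free_loop F1P) // (rule_free_loop F2P) //; congr (_ * _).
  by apply: IH; rewrite /= -ltnS -addnS prednK.
have Fu (H : mgraph) (v x : vertex H) :
    #|vertex H| = #|vertex G| -> free_loops H = free_loops G ->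
    adj v x -> u_or_ur (mark x) -> F1 H = F2 H.
  (* Complementing at [v] turns the mark u of its neighbor [x] into cr, and ur into c. *)
  move=> cH fH vx ux; rewrite (rule_u_neighbor F1P vx ux) (rule_u_neighbor F2P vx ux).
  apply: (Fc (mlc v) x) => //=; rewrite /lc_mark vx.
  have [xv|_] := eqVneq x v; first by move: vx; rewrite xv adj_irr.
  by case: (mark x) ux.
case: (pickP (fun v : vertex G => true)) => [v _|G0]; last first.
  by rewrite (rule_empty F1P) ?(rule_empty F2P) // eq_card0.
have [/existsP[x vx]|niso] := boolP [exists x, adj v x].
  have [cx|ncx] := boolP (c_or_cr (mark x)); first exact: (Fc G x).
  have [ux|nux] := boolP (u_or_ur (mark x)); first exact: (Fu G v x).
  have rx : unmarked_or_r (mark x) by case: (mark x) ncx nux.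
  (* Complementing at [x] gives it the mark u or ur and preserves the edge from [v] to [x], since
     only edges between neighbors of [x] are toggled. *)
  rewrite (rule_unmarked_or_r F1P rx) (rule_unmarked_or_r F2P rx).
  apply: (Fu (mlc x) v x) => //=.
    by rewrite /lc_adj adj_irr !andbF addbF.
  by rewrite /lc_mark eqxx; case: (mark x) rx.
have iso : isolated v by move=> x; apply: contra niso => vx; apply/existsP; exists x.
rewrite (rule_isolated F1P iso) (rule_isolated F2P iso) IHdel //; congr (_ * _).
pose v1 : vertex (one_vertex (mark v) (looped v)) := tt.
by rewrite (rule_one_vertex F1P v1) ?(rule_one_vertex F2P v1) ?card_unit.
Qed.

End Uniqueness.

Theorem theorem1 :
  bracket_rules bracket /\
  (forall F : mgraph -> ZABd,
     bracket_rules F -> forall G : mgraph, F G = bracket G).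
Proof.
split; first exact: bracket_rules_bracket.
by move=> F FP G; apply: bracket_rules_unique bracket_rules_bracket G.
Qed.
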